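(* Let $T$ be a tree, let $\lambda: T\to(0,\infty)$ be a weight, let $1\le p<\infty$, and let $\varphi:T\to T$ be an injective self-map such that $C_\varphi$ is bounded on $L^p_\lambda(T)$. If $C_\varphi$ is compact on $L^p_\lambda(T)$, then $$\lim_{N\to\infty}\ \sup_{|\varphi(v)|\ge N}\frac{\lambda(v)}{\lambda(\varphi(v))}=0.$$
   Context: A tree $T$ is a connected, locally finite graph without cycles on a countably infinite vertex set (identified with $T$), with a fixed vertex $o$ called the root, and with no terminal vertices (a terminal vertex is one having only one neighbour). For a vertex $v$, $|v|$ denotes the length (number of edges) of the unique path joining $o$ and $v$. Functions on $T$ are functions on its vertices. For a weight $\lambda:T\to(0,\infty)$ and $1\le p<\infty$, $L^p_\lambda(T)$ is the Banach space of functions $f:T\to\mathbb{C}$ with $\|f\|_p=\big[\sum_{v\in T}|f(v)|^p\lambda(v)\big]^{1/p}<\infty$. For a self-map $\varphi$ of $T$, the composition operator $C_\varphi$ is $C_\varphi f(v)=f(\varphi(v))$; it is bounded on $L^p_\lambda(T)$ if it maps $L^p_\lambda(T)$ into itself and is a bounded linear operator there. The supremum over $|\varphi(v)|\ge N$ is over all $v\in T$ with $|\varphi(v)|\ge N$. *)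

(* Defs.v *)
From HB Require Import structures.
From mathcomp Require Import all_boot all_order all_algebra.
From mathcomp Require Import complex.
From mathcomp Require Import all_classical all_reals all_analysis.
From mathcomp Require Import ring.
Set Implicit Arguments.
Unset Strict Implicit.
Unset Printing Implicit Defensive.
Import Order.TTheory GRing.Theory Num.Theory.
Import numFieldNormedType.Exports.
Import Normc.
Local Open Scope classical_set_scope.
Local Open Scope ring_scope.
Local Open Scope complex_scope.

(* Simple cycles are duplicate-free cyclic sequences of adjacent vertices;
   those of size 2 merely traverse one edge back and forth. *)
Record rooted_tree (T : choiceType) := RootedTree {
  adj : rel T ;
  root : T ;
  adj_sym : symmetric adj ;
  adj_irr : irreflexive adj ;
  tree_countable : ([set: T] #= [set: nat])%card ;
  tree_connected : forall u v, exists s, path adj u s /\ last u s = v ;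
  tree_acyclic : forall c, (2 < size c)%N -> cycle adj c -> ~~ uniq c ;
  tree_locally_finite : forall v, finite_set [set w | adj v w] ;
  tree_no_terminal : forall v, ~ exists w, [set u | adj v u] = [set w]
}.

Section tree_level.
Context (T : choiceType) (G : rooted_tree T).

Definition simple_path (u v : T) : set (seq T) :=
  [set s | [/\ path (adj G) u s, last u s = v & uniq (u :: s)]].

Definition level (v : T) : nat := size (xget [::] (simple_path (root G) v)).

Lemma simple_path_ex u v : exists s, simple_path u v s.
Proof.
have [s [ps <-]] := tree_connected G u v.
by case: (shortenP ps) => s' ps' us' _; exists s'; split.
Qed.

End tree_level.

Section weighted_sum.
Context (R : realType) (T : choiceType) (lambda : T -> R) (p : R).

Definition lp_sum (f : T -> R[i]) : \bar R :=
  \esum_(v in [set: T]) (normc (f v) `^ p * lambda v)%:E.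

Definition lp_fun : {pred T -> R[i]} := fun f => (lp_sum f < +oo)%E.

Definition lp_norm (f : T -> R[i]) : R := fine (lp_sum f) `^ p^-1.

(* The hypotheses on lambda and p are parameters of the type so that the
   normed space structure declared below can be inferred from it. *)
Record lp_space (lambda_gt0 : forall v, 0 < lambda v) (p_ge1 : 1 <= p) :=
  LpSpace { lp_val :> T -> R[i] ; lp_valP : lp_val \in lp_fun }.

End weighted_sum.

Lemma normc_ge0 (R : realType) (z : R[i]) : 0 <= normc z.
Proof. by case: z => a b; exact: sqrtr_ge0. Qed.

Lemma ge0_le_esumZ (R : realType) (T : choiceType) (c : R) (a : T -> R) :
  0 <= c -> (forall t, 0 <= a t) ->
  (\esum_(t in [set: T]) (c * a t)%:E
     <= c%:E * \esum_(t in [set: T]) (a t)%:E)%E.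
Proof.
move=> c0 a0; apply: ge_ereal_sup => /= _ [X [finX _] <-].
under eq_fsbigr do rewrite EFinM.
rewrite -ge0_mule_fsumr; last by move=> t; rewrite lee_fin.
by apply: lee_wpmul2l; rewrite ?lee_fin//; apply: ereal_sup_ubound; exists X.
Qed.

Section lp_type.
Context (R : realType) (T : choiceType) (lambda : T -> R)
  (lambda_gt0 : forall v, 0 < lambda v) (p : R) (p_ge1 : 1 <= p).

Local Notation S := (lp_sum lambda p).
Local Notation N := (lp_norm lambda p).

Let p_gt0 : 0 < p. Proof. exact: lt_le_trans p_ge1. Qed.

Let term_ge0 (f : T -> R[i]) v : 0 <= normc (f v) `^ p * lambda v.
Proof. by rewrite mulr_ge0 ?powR_ge0// ltW. Qed.

Lemma lp_sum_ge0 f : (0 <= S f)%E.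
Proof. by apply: esum_ge0 => v _; rewrite lee_fin. Qed.

Lemma lp_sum_fin f : f \in lp_fun lambda p -> S f \is a fin_num.
Proof. by move=> fS; rewrite ge0_fin_numE ?lp_sum_ge0. Qed.

Lemma lp_norm_ge0 f : 0 <= N f.
Proof. exact: powR_ge0. Qed.

Lemma lp_sumE f : f \in lp_fun lambda p -> S f = (N f `^ p)%:E.
Proof.
move=> fS; rewrite /lp_norm -powRrM mulVf ?gt_eqF// powRr1 ?fineK//.
  exact: lp_sum_fin.
by rewrite fine_ge0// lp_sum_ge0.
Qed.

Lemma lp_norm_le f a : 0 <= a -> (S f <= (a `^ p)%:E)%E -> N f <= a.
Proof.
move=> a0 Sa; have fS : f \in lp_fun lambda p by exact: le_lt_trans Sa (ltry _).
rewrite leNgt; apply/negP => aN; move: Sa; rewrite lp_sumE// lee_fin leNgt.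
by rewrite gt0_ltr_powR// nnegrE (le_trans a0)// ltW.
Qed.

Lemma lp_sumZ_le c f : (S (c *: f) <= (normc c `^ p)%:E * S f)%E.
Proof.
apply: le_trans (ge0_le_esumZ (powR_ge0 _ _) (term_ge0 f)).
apply: le_esum => v _; rewrite lee_fin.
have -> : (c *: f) v = c * f v by [].
by rewrite normcM powRM ?normc_ge0// mulrA.
Qed.

Lemma powRD_le (x y a b : R) : 0 <= x -> 0 <= y -> 0 < a -> 0 < b ->
  (x + y) `^ p <= (a + b) `^ p * (a / (a + b)) / a `^ p * x `^ p +
                  (a + b) `^ p * (b / (a + b)) / b `^ p * y `^ p.
Proof.
move=> x0 y0 a0 b0.
have ab0 : 0 < a + b by exact: addr_gt0.
have t01 : 0 <= a / (a + b) <= 1.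
  by rewrite divr_ge0 ?(ltW a0) ?(ltW ab0)//= ler_pdivrMr// mul1r lerDl ltW.
have /andP[t0 t1] := t01.
have xa : 0 <= x / a by rewrite divr_ge0// ltW.
have yb : 0 <= y / b by rewrite divr_ge0// ltW.
have : (a / (a + b) * (x / a) + (1 - a / (a + b)) * (y / b)) `^ p <=
    a / (a + b) * (x / a) `^ p + (1 - a / (a + b)) * (y / b) `^ p.
  by apply: (convex_powR p_ge1 (Itv01 t0 t1));
    rewrite inE/= in_itv/= andbT.
have -> : 1 - a / (a + b) = b / (a + b) by field; rewrite gt_eqF.
have ->: a / (a + b) * (x / a) + b / (a + b) * (y / b) = (x + y) / (a + b).
  by field; rewrite !gt_eqF.
set t := a / (a + b); set u := b / (a + b).
have powRV z c : 0 <= z -> 0 < c -> z `^ p = c `^ p * (z / c) `^ p.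
  move=> z0 c0; rewrite -powRM ?divr_ge0 ?(ltW c0)//.
  by rewrite mulrC divfK// gt_eqF.
rewrite (powRV x a)// (powRV y b)// (powRV (x + y) (a + b)) ?addr_ge0//.
move=> /(ler_wpM2l (powR_ge0 (a + b) p)) /le_trans; apply.
rewrite le_eqVlt; apply/orP; left; apply/eqP; field.
by rewrite !gt_eqF// powR_gt0.
Qed.

Lemma lp_sumD_le (f g : T -> R[i]) (a b : R) : 0 < a -> 0 < b ->
  (S f <= (a `^ p)%:E)%E -> (S g <= (b `^ p)%:E)%E ->
  (S (f + g)%R <= ((a + b)%R `^ p)%:E)%E.
Proof.
move=> a0 b0 Sf Sg; have ab0 : 0 < a + b by exact: addr_gt0.
set ca := (a + b) `^ p * (a / (a + b)) / a `^ p.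
set cb := (a + b) `^ p * (b / (a + b)) / b `^ p.
have ca0 : 0 <= ca by rewrite !mulr_ge0 ?invr_ge0 ?powR_ge0// ltW.
have cb0 : 0 <= cb by rewrite !mulr_ge0 ?invr_ge0 ?powR_ge0// ltW.
apply: (@le_trans _ _ (ca%:E * S f + cb%:E * S g)%E); last first.
  have -> : (a + b) `^ p = ca * a `^ p + cb * b `^ p.
    by rewrite /ca /cb; field; rewrite !gt_eqF// powR_gt0.
  by rewrite EFinD !EFinM leeD// lee_wpmul2l// lee_fin.
apply: le_trans (leeD (ge0_le_esumZ ca0 (term_ge0 f))
                      (ge0_le_esumZ cb0 (term_ge0 g))).
rewrite -esumD; do ?by move=> v _; rewrite lee_fin mulr_ge0.
apply: le_esum => v _; rewrite -EFinD lee_fin !mulrA -mulrDl.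
rewrite ler_wpM2r//; first exact: ltW.
apply: le_trans (powRD_le (normc_ge0 _) (normc_ge0 _) a0 b0).
by rewrite ge0_ler_powR ?(ltW p_gt0)// ?nnegrE ?addr_ge0 ?normc_ge0// le_normcD.
Qed.

Lemma lp_sum_le f a : f \in lp_fun lambda p -> N f <= a ->
  (S f <= (a `^ p)%:E)%E.
Proof.
move=> fS fa; rewrite lp_sumE// lee_fin ge0_ler_powR ?(ltW p_gt0)//.
  by rewrite nnegrE lp_norm_ge0.
by rewrite nnegrE (le_trans _ fa)// lp_norm_ge0.
Qed.

Lemma lp_submod_closed : submod_closed (lp_fun lambda p).
Proof.
have zeroP : 0 \in lp_fun lambda p.
  rewrite /lp_fun unfold_in /lp_sum esum1 ?ltry// => v _.
  by rewrite [normc _]normc0 powR0 ?mul0r ?gt_eqF.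
split=> // c f g fP gP.
have cfP : c *: f \in lp_fun lambda p.
  by apply: le_lt_trans (lp_sumZ_le c f) _; rewrite lp_sumE// -EFinM ltry.
have pos h : 0 < N h + 1 by rewrite ltr_wpDl ?lp_norm_ge0.
have le1 h : h \in lp_fun lambda p -> (S h <= ((N h + 1) `^ p)%:E)%E.
  by move=> hP; apply: lp_sum_le; rewrite ?lerDl.
have := lp_sumD_le (pos (c *: f)) (pos g) (le1 _ cfP) (le1 _ gP).
by move/le_lt_trans; apply; exact: ltry.
Qed.

HB.instance Definition _ :=
  GRing.isSubmodClosed.Build _ _ (lp_fun lambda p) lp_submod_closed.

Local Notation L := (lp_space lambda_gt0 p_ge1).

HB.instance Definition _ := [isSub of L for @lp_val _ _ _ _ _ _].
HB.instance Definition _ := [Choice of L by <:].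
HB.instance Definition _ := [SubChoice_isSubLmodule of L by <:].

Lemma lp_norm_triangle (f g : L) :
  (N (f + g : L))%:C <= (N f)%:C + (N g)%:C :> R[i].
Proof.
rewrite -rmorphD/= lecR; apply/ler_addgt0Pr => e e0.
have e2 : 0 < e / 2 by rewrite divr_gt0.
have pos h : 0 < N h + e / 2 by rewrite ltr_wpDl ?lp_norm_ge0.
have le1 (h : L) : (S h <= ((N h + e / 2) `^ p)%:E)%E.
  by apply: lp_sum_le (lp_valP h) _; rewrite lerDl ltW.
rewrite (splitr e) addrACA.
apply: lp_norm_le; first by rewrite addr_ge0 ?ltW.
exact: lp_sumD_le.
Qed.

Lemma lp_normZ_le c (f : L) : N (c *: f : L) <= normc c * N f.
Proof.
apply: lp_norm_le; first by rewrite mulr_ge0 ?normc_ge0 ?lp_norm_ge0.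
apply: le_trans (lp_sumZ_le c f) _.
by rewrite (lp_sumE (lp_valP f)) powRM ?normc_ge0 ?lp_norm_ge0.
Qed.

Lemma lp_norm0 : N (0 : L) = 0.
Proof.
apply/eqP; rewrite eq_le lp_norm_ge0 andbT -(scale0r (0 : L)).
by apply: le_trans (lp_normZ_le _ _) _; rewrite [normc _]normc0 mul0r.
Qed.

Lemma lp_normZ (c : R[i]) (f : L) : (N (c *: f : L))%:C = `|c| * (N f)%:C.
Proof.
have -> : `|c| = (normc c)%:C by [].
rewrite -rmorphM/=; congr (_%:C); have [->|c0] := eqVneq c 0.
  by rewrite scale0r lp_norm0 [normc _]normc0 mul0r.
apply/eqP; rewrite eq_le lp_normZ_le/=.
have nc0 : 0 < normc c.
  by rewrite lt_neqAle normc_ge0 andbT eq_sym; apply: contra_neq c0 => /eq0_normc.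
rewrite mulrC -ler_pdivlMr// mulrC -normcV.
by rewrite -{1}(scale1r f) -(mulVf c0) -scalerA lp_normZ_le.
Qed.

Lemma lp_norm_eq0 (f : L) : (N f)%:C = 0 -> f = 0.
Proof.
move=> [N0]; apply/val_inj/funext => v /=.
have : ((normc (f v) `^ p * lambda v)%:E <= S f)%E.
  rewrite -(esum_set1 (a := fun v => (normc (f v) `^ p * lambda v)%:E)).
    apply: ereal_sup_le => /= _ [X [finX _] <-]; exists X => //.
  by rewrite lee_fin.
rewrite (lp_sumE (lp_valP f)) N0 powR0 ?gt_eqF// lee_fin.
rewrite pmulr_lle0// => h; apply: eq0_normc; apply/eqP.
by move: h; rewrite le_eqVlt ltNge powR_ge0 orbF powR_eq0 => /andP[].
Qed.

HB.instance Definition _ := @Lmodule_isNormed.Build R[i] L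
  (fun f => (N f)%:C) lp_norm_triangle lp_normZ lp_norm_eq0.

Lemma lp_normE (f : L) : `|f| = (N f)%:C.
Proof. by []. Qed.

End lp_type.

Section operators.
Context (K : numFieldType) (V W : normedModType K).

Definition bounded_operator (u : V -> W) :=
  linear u /\ exists M : K, forall x, `|u x| <= M * `|x|.

Definition compact_operator (u : V -> W) :=
  linear u /\ compact (closure (u @` [set x | `|x| <= 1])).

End operators.

Section composition.
Context (R : realType) (T : choiceType) (lambda : T -> R) (p : R) (phi : T -> T).

Definition lp_stable :=
  forall f, f \in lp_fun lambda p -> f \o phi \in lp_fun lambda p.

Context (lambda_gt0 : forall v, 0 < lambda v) (p_ge1 : 1 <= p)
  (phi_lp : lp_stable).

Local Notation L := (lp_space lambda_gt0 p_ge1).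

Definition comp_op (f : L) : L := LpSpace _ _ (phi_lp (lp_valP f)).

Let comp_op_linear : linear comp_op.
Proof. by move=> c f g; apply/val_inj. Qed.

HB.instance Definition _ :=
  GRing.isLinear.Build R[i] L L *:%R comp_op comp_op_linear.

End composition.

Arguments comp_op {R T lambda p phi} lambda_gt0 p_ge1 phi_lp f.

(* Main.v *)
(* For each vertex [v], [C_phi] maps the normalized indicator of [phi v] to a
   function supported on [{v}] (as [phi] is injective), whose norm to the power
   [p] is [lambda v / lambda (phi v)]. Functions with disjoint supports are at
   least as far apart as the norm of either, so by compactness only finitely
   many of these ratios can be at least a given [e > 0]. Local finiteness bounds the
   number of vertices below each level; since [T] is infinite, this makes the
   suprema range over nonempty sets (an empty one would give [-oo]). *)
Require Import Defs.
From mathcomp Require Import all_boot all_order all_algebra.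
From mathcomp Require Import all_classical all_reals all_analysis.
From mathcomp Require Import complex.
Set Implicit Arguments.
Unset Strict Implicit.
Unset Printing Implicit Defensive.
Import Order.TTheory GRing.Theory Num.Theory.
Import numFieldNormedType.Exports.
Import Normc.
Local Open Scope classical_set_scope.
Local Open Scope ring_scope.

(** By compactness the sequence has a cluster point, and two terms with distinct indices within
    [d / 2] of it are less than [d] apart. *)
Lemma compact_no_separated_seq (K : numFieldType) (V : normedModType K)
    (A : set V) (u : nat -> V) (d : K) :
  0 < d -> compact A -> (forall n, A (u n)) ->
  ~ (forall n m, n <> m -> d <= `|u n - u m|).
Proof.
move=> d0 cptA Au sep.
have uA : (u @ \oo) A by exists 0%N => // n _ /=; exact: Au.
have [x [_ clx]] := cptA _ _ uA.
have d2 : 0 < d / 2 by rewrite divr_gt0.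
have near_x N : exists2 n, (N <= n)%N & `|x - u n| < d / 2.
  have [||y [[n /= Nn <-] xn]] := clx (u @` [set n | (N <= n)%N]) (ball x (d / 2)).
  - by exists N => // n /= Nn; exists n.
  - exact: nbhsx_ballx.
  - by exists n => //; move: xn; rewrite -ball_normE.
(* Searching from [n.+1] on forces the second index to differ from the first. *)
have [n _ xn] := near_x 0%N; have [m nm xm] := near_x n.+1.
have : `|u n - u m| < d.
  rewrite (le_lt_trans (ler_distD x _ _))// (splitr d) distrC.
  exact: ltrD.
have nNm : n <> m by move=> nm'; rewrite nm' ltnn in nm.
by move=> /(le_lt_trans (sep _ _ nNm)); rewrite ltxx.
Qed.

Lemma infinite_set_injseq (T : Type) (A : set T) : infinite_set A ->
  exists h : nat -> T, (forall n, A (h n)) /\ injective h.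
Proof.
move=> /infiniteP/card_leP/unsquash h.
exists (fun n => set_val (h (to_setT n))); split=> [n|n m /val_inj].
  exact: set_valP.
by move=> /('inj_h); rewrite !inE => /(_ I I)/(congr1 set_val).
Qed.

(** Induction on the length: a walk of length [n.+1] ends at a successor of the end of a walk of
    length [n], so its possible ends form a finite union of finite sets. *)
Lemma finite_last_path (T : choiceType) (e : rel T) (x : T) (n : nat) :
  (forall y, finite_set [set z | e y z]) ->
  finite_set [set y | exists s, [/\ size s = n, path e x s & last x s = y]].
Proof.
move=> fin_e; elim: n => [|n IHn].
  by apply: sub_finite_set (finite_set1 x) => y [s [/size0nil -> _]] /= <-.
apply: sub_finite_set (bigcup_finite IHn (fun y _ => fin_e y)) => y [s].
case/lastP: s => [[]//|s z] [].
rewrite size_rcons rcons_path last_rcons => -[sn] /andP[xs sz] <-.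
by exists (last x s) => //; exists s.
Qed.

Lemma finite_level_lt (T : choiceType) (G : rooted_tree T) (N : nat) :
  finite_set [set v | (level G v < N)%N].
Proof.
have fin n := finite_last_path (Defs.root G) n (@tree_locally_finite _ G).
apply: sub_finite_set (bigcup_finite (finite_II N) (fun n _ => fin n)) => v vN.
exists (level G v) => //=.
rewrite /level; case: xgetP => [s _ [ps ls _]|noP]; first by exists s.
(* The default case of [xget] cannot arise, since a simple path from the root exists. *)
by have [s] := simple_path_ex G (Defs.root G) v; move/noP.
Qed.

Section lp.
Context (R : realType) (T : choiceType) (lambda : T -> R)
  (lambda_gt0 : forall v, 0 < lambda v) (p : R) (p_ge1 : 1 <= p).

Let p_gt0 : 0 < p. Proof. exact: lt_le_trans p_ge1. Qed.

(** The exponent makes the [p]-th power of the peak value cancel the weight at [u], so the norm is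
    1. *)
Definition lp_peak (u v : T) : R[i] :=
  if v == u then (lambda u `^ (- p^-1))%:C%C else 0.

Lemma normc_lp_peak u : normc (lp_peak u u) `^ p = (lambda u)^-1.
Proof.
rewrite /lp_peak eqxx /= expr0n addr0 sqrtr_sqr ger0_norm ?powR_ge0//.
by rewrite -powRrM mulNr mulVf ?gt_eqF// powR_inv1// ltW.
Qed.

Lemma lp_sum_peak u : lp_sum lambda p (lp_peak u) = 1%E.
Proof.
pose a v := (normc (lp_peak u v) `^ p * lambda v)%:E.
have a_ge0 v : (0 <= a v)%E by rewrite lee_fin mulr_ge0 ?powR_ge0// ltW.
transitivity (\esum_(v in [set u]) a v)%E; last first.
  by rewrite esum_set1// /a normc_lp_peak mulVf// gt_eqF.
rewrite [RHS]esum_mkcond; apply: eq_esum => v _.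
case: ifPn => // /negP; rewrite inE /= /lp_peak => /eqP/negPf ->.
by rewrite [normc _]normc0 powR0 ?mul0r ?gt_eqF.
Qed.

Lemma lp_peak_lp u : lp_peak u \in lp_fun lambda p.
Proof. by rewrite /lp_fun unfold_in lp_sum_peak ltry. Qed.

Lemma lp_term_le_sum (f : T -> R[i]) v :
  ((normc (f v) `^ p * lambda v)%:E <= lp_sum lambda p f)%E.
Proof.
rewrite -(esum_set1 (a := fun v => (normc (f v) `^ p * lambda v)%:E)).
  by apply: ereal_sup_le => /= _ [X [finX _] <-]; exists X.
by rewrite lee_fin mulr_ge0 ?powR_ge0// ltW.
Qed.

Lemma compact_comp_op_finite (phi : T -> T) (phi_lp : lp_stable lambda p phi)
    (e : R) :
  injective phi -> compact_operator (comp_op lambda_gt0 p_ge1 phi_lp) -> 0 < e ->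
  finite_set [set v | e <= lambda v / lambda (phi v)].
Proof.
move=> phi_inj [_ cptC] e0; apply: contrapT => /infinite_set_injseq[h [hA h_inj]].
pose peak v := LpSpace lambda_gt0 p_ge1 (lp_peak_lp (phi v)).
pose u n := comp_op lambda_gt0 p_ge1 phi_lp (peak (h n)).
(* The separation constant is the [p]-th root of [e], because the ratios bound [p]-th powers of
   norms. *)
have d0 : 0 < (e `^ p^-1)%:C%C :> R[i] by rewrite ltcR powR_gt0.
apply: (compact_no_separated_seq (u := u) d0 cptC) => [n|n m nm].
  apply: subset_closure; exists (peak (h n)) => //=.
  by rewrite lp_normE lecR /lp_norm lp_sum_peak powR1.
have hnm : h n <> h m by move=> /h_inj.
(* Injectivity of [phi] makes [u m] vanish at [h n]. *)
have un : (u n - u m) (h n) = lp_peak (phi (h n)) (phi (h n)).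
  have -> : (u n - u m) (h n) =
      lp_peak (phi (h n)) (phi (h n)) - lp_peak (phi (h m)) (phi (h n)) by [].
  by rewrite [X in _ - X]ifN ?subr0//; apply/eqP => /phi_inj.
(* The single term at [h n] equals [lambda (h n) / lambda (phi (h n))], which is at least [e]; this
   already bounds the whole norm from below. *)
have := lp_term_le_sum (u n - u m) (h n).
rewrite un normc_lp_peak lp_sumE ?lp_valP// lee_fin mulrC => le_norm.
rewrite lp_normE lecR.
have pV0 : 0 <= p^-1 by rewrite invr_ge0 ltW.
have := ge0_ler_powR pV0 _ _ (le_trans (hA n) le_norm).
rewrite -powRrM mulfV ?gt_eqF// powRr1 ?lp_norm_ge0//; apply.
  by rewrite nnegrE ltW.
by rewrite nnegrE powR_ge0.
Qed.

End lp.

(** The finitely many points where [f] is at least [e] have bounded [l], so they drop out of the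
    supremum once [N] is large. *)
Lemma ereal_sup_cvg0 (R : realType) (T : Type) (f : T -> R) (l : T -> nat) :
  (forall v, 0 <= f v) ->
  (forall N, exists v, (N <= l v)%N) ->
  (forall e, 0 < e -> finite_set [set v | e <= f v]) ->
  (fun N : nat => ereal_sup [set (f v)%:E | v in [set v | (N <= l v)%N]])
    @ \oo --> 0%E.
Proof.
move=> f0 lN finf.
pose S N := ereal_sup [set (f v)%:E | v in [set v | (N <= l v)%N]].
rewrite -[X in X @ _]/S.
have sup_ge0 N : (0 <= S N)%E.
  have [v Nv] := lN N; apply: (@le_trans _ _ (f v)%:E); first by rewrite lee_fin.
  by apply: ereal_sup_ubound; exists v.
have sup_le e : 0 < e -> \forall N \near \oo, (S N <= e%:E)%E.
  move=> /finf /(finite_image l) /finite_seqP[s ls].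
  (* The threshold lies one above the largest [l]-value of an exceptional point. *)
  exists (\max_(n <- s) n).+1 => // N /= sN.
  apply: ge_ereal_sup => _ [v /= Nv <-]; rewrite lee_fin leNgt; apply/negP => ev.
  have : [set` s] (l v) by rewrite -ls; exists v => //=; exact: ltW.
  move=> /(@leq_bigmax_seq _ s xpredT id)/(_ isT) lvs.
  by have := leq_trans (leq_trans sN Nv) lvs; rewrite ltnn.
(* Convergence splits into eventual finiteness, for which the bound with [e = 1] suffices, and
   convergence of the real values. *)
apply/fine_cvgP; split.
  near=> N; rewrite ge0_fin_numE//; apply: le_lt_trans (ltry 1).
  by near: N; exact: sup_le.
apply/cvgrPdist_le => e e0; near=> N.
rewrite /= sub0r normrN ger0_norm ?fine_ge0//.
have : (S N <= e%:E)%E by near: N; exact: sup_le.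
by case: (S N) (sup_ge0 N).
Unshelve. all: by end_near.
Qed.

Theorem theorem4p4 (R : realType) (T : choiceType) (G : rooted_tree T)
    (lambda : T -> R) (lambda_gt0 : forall v, 0 < lambda v)
    (p : R) (p_ge1 : 1 <= p)
    (phi : T -> T) (phi_inj : injective phi)
    (phi_lp : lp_stable lambda p phi)
    (phi_bounded : bounded_operator (comp_op lambda_gt0 p_ge1 phi_lp))
    (phi_compact : compact_operator (comp_op lambda_gt0 p_ge1 phi_lp)) :
  (fun N : nat => ereal_sup [set (lambda v / lambda (phi v))%:E
                            | v in [set v | (N <= level G (phi v))%N]])
    @ \oo --> 0%E.
Proof.
apply: ereal_sup_cvg0 => [v|N|e e0]; first by rewrite divr_ge0// ltW.
  (* Otherwise the range of [phi] would lie among the finitely many vertices of level below [N],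
     although injectivity makes it equinumerous with the infinite set [T]. *)
  apply: contrapT => noN; apply: infinite_nat.
  rewrite -(eq_finite_set (tree_countable G)).
  rewrite -(eq_finite_set (inj_card_eq (f := phi) (in2W phi_inj))).
  apply: sub_finite_set (finite_level_lt G N) => _ [v _ <-] /=.
  by rewrite ltnNge; apply/negP => Nv; apply: noN; exists v.
exact: compact_comp_op_finite phi_compact e0.
Qed.
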